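(* Let $d$, $\Delta$, and $s$ be integers satisfying $1\le d\le\Delta$ and $0\le s<d$. Let $G$ be a finite simple $d$-degenerate graph with maximum degree $\Delta(G)\le\Delta$ and $q_B(G)\ge d\Delta-s$. Then some vertex $v$ of $G$ has distinct neighbors $u_1,\ldots,u_d$ such that $d_G(u_1)=\Delta$ and $$\sum_{j=2}^{d}|N_G(u_1)\setminus N_G(u_j)|\le s,\qquad \sum_{j=2}^{d}|N_G(u_1)\oplus N_G(u_j)|\le2s.$$ Consequently, at least $d-s$ of $u_1,\ldots,u_d$ have degree $\Delta$ and the same open neighborhood. In particular, $G$ contains copies of $K_{d-s,\Delta}$ and $K_{d,\Delta-s}$.
   Context: A $B$-coloring of a graph $G$ is a proper edge-coloring (incident edges receive distinct colors) in which the edges of every $4$-cycle receive four distinct colors; $q_B(G)$ is the minimum number of colors in a $B$-coloring of $G$. A graph is $d$-degenerate if every nonempty subgraph has a vertex of degree at most $d$ (in that subgraph). ''Contains a copy of $K_{a,b}$'' means contains a subgraph, not necessarily induced, isomorphic to the complete bipartite graph $K_{a,b}$. $N_G(x)$ is the open neighborhood of $x$, $d_G(x)$ its degree, $\Delta(G)$ the maximum degree of $G$, and $A\oplus B=(A\setminus B)\cup(B\setminus A)$. *)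

(* Defs.v *)
From mathcomp Require Import all_boot.

Set Implicit Arguments.
Unset Strict Implicit.
Unset Printing Implicit Defensive.

Record sgraph := SGraph {
  vertex :> finType;
  adj : rel vertex;
  adj_sym : symmetric adj;
  adj_irr : irreflexive adj }.

Definition nbh (G : sgraph) (x : G) : {set G} := [set y | adj x y].

Definition degree (G : sgraph) (x : G) : nat := #|nbh x|.

Definition max_degree (G : sgraph) : nat := \max_(x : G) degree x.

Definition symdiff (T : finType) (A B : {set T}) : {set T} :=
  (A :\: B) :|: (B :\: A).

(* Not necessarily induced: both vertices and edges may be deleted. *)
Record subgraph (G : sgraph) := Subgraph {
  sub_verts : {set G};
  sub_adj : rel G;
  sub_adj_sym : symmetric sub_adj;
  sub_adj_incl : forall x y, sub_adj x y ->
    [/\ x \in sub_verts, y \in sub_verts & adj x y] }.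

Definition sub_degree (G : sgraph) (H : subgraph G) (x : G) : nat :=
  #|[set y | sub_adj H x y]|.

Definition degenerate (d : nat) (G : sgraph) : Prop :=
  forall H : subgraph G, sub_verts H != set0 ->
    exists2 x, x \in sub_verts H & sub_degree H x <= d.

Definition edges (G : sgraph) : {set {set G}} :=
  [set [set p.1; p.2] | p : G * G & adj p.1 p.2].

(* Colorings are defined on this subtype, and not on all of {set G}, so that
   an edgeless graph is colored with 0 colors. *)
Definition edge (G : sgraph) := {X : {set G} | X \in edges G}.

Definition proper_coloring (G : sgraph) (k : nat) (c : {ffun edge G -> 'I_k})
    : bool :=
  [forall X, forall Y,
     (X != Y) && (val X :&: val Y != set0) ==> (c X != c Y)].

Definition is_C4 (G : sgraph) (x y z w : G) : bool :=
  uniq [:: x; y; z; w] && cycle (@adj G) [:: x; y; z; w].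

Definition C4_edges (G : sgraph) (x y z w : G) : {set {set G}} :=
  [set [set x; y]; [set y; z]; [set z; w]; [set w; x]].

Definition rainbow_C4 (G : sgraph) (k : nat) (c : {ffun edge G -> 'I_k})
    : bool :=
  [forall x : G, forall y : G, forall z : G, forall w : G,
     is_C4 x y z w ==>
     [forall X, forall Y,
        [&& val X \in C4_edges x y z w, val Y \in C4_edges x y z w & X != Y]
          ==> (c X != c Y)]].

Definition B_coloring (G : sgraph) (k : nat) (c : {ffun edge G -> 'I_k})
    : bool :=
  proper_coloring c && rainbow_C4 c.

Definition B_colorable (G : sgraph) (k : nat) : bool :=
  [exists c : {ffun edge G -> 'I_k}, B_coloring c].

Lemma B_colorable_ex (G : sgraph) : exists k, B_colorable G k.
Proof.
exists #|{: edge G}|; apply/existsP; exists [ffun X => enum_rank X].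
apply/andP; split.
  apply/forallP => X; apply/forallP => Y; apply/implyP => /andP[XY _].
  by rewrite !ffunE (inj_eq enum_rank_inj).
apply/forallP => x; apply/forallP => y; apply/forallP => z; apply/forallP => w.
apply/implyP => _; apply/forallP => X; apply/forallP => Y.
apply/implyP => /and3P[_ _ XY].
by rewrite !ffunE (inj_eq enum_rank_inj).
Qed.

Definition qB (G : sgraph) : nat := ex_minn (B_colorable_ex G).

Definition Kab_adj (a b : nat) : rel ('I_a + 'I_b) := fun x y =>
  match x, y with
  | inl _, inr _ | inr _, inl _ => true
  | _, _ => false
  end.

Lemma Kab_sym (a b : nat) : symmetric (@Kab_adj a b).
Proof. by case=> ? []. Qed.

Lemma Kab_irr (a b : nat) : irreflexive (@Kab_adj a b).
Proof. by case. Qed.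

Definition Kab (a b : nat) : sgraph := SGraph (@Kab_sym a b) (@Kab_irr a b).

Definition contains_copy (G H : sgraph) : Prop :=
  exists (S : subgraph G) (f : H -> G),
    [/\ injective f, f @: [set: H] = sub_verts S
      & forall x y : H, sub_adj S (f x) (f y) = adj x y].

(* Main.v *)
(* Remove, one after the other, vertices having at most d neighbours among the
   remaining ones, and color the edges greedily in the reverse order, all edges
   from a new vertex v to the current vertex set W being colored together.  The
   edges conflicting with vu inside W all have the form wx with w a neighbour
   of v and x a common neighbour of u and w in W (and x <> v if w = u), so there
   are at most deg(u) - 1 + \sum_(w != u) |N(u) :&: N(w)| of them.  If no
   coloring with d * Delta - s - 1 colors exists, some edge vu has at least that
   many conflicts; as s < d <= Delta, this forces v to have d neighbours in W,
   deg(u) = Delta and a total defect \sum_(w != u) |N(u) :\: N(w)| <= s. *)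
Require Import Defs.
From mathcomp Require Import all_boot zify.

Set Implicit Arguments.
Unset Strict Implicit.
Unset Printing Implicit Defensive.

Lemma card_bigcup_le (I T : finType) (P : pred I) (F : I -> {set T}) :
  #|\bigcup_(i | P i) F i| <= \sum_(i | P i) #|F i|.
Proof.
elim/big_rec2: _ => [|i m A _ IH]; first by rewrite cards0.
by apply: leq_trans (leq_card_setU _ _) _; apply: leq_add.
Qed.

(** * Greedy coloring for an arbitrary symmetric conflict relation *)

Section Greedy.
Variables (T : finType) (R : rel T) (k : nat).
Hypothesis R_sym : symmetric R.

Definition partially_colorable (D : {set T}) : Prop :=
  exists c : T -> nat, {in D, forall x, c x < k} /\
    {in D &, forall x y, x != y -> R x y -> c x != c y}.

Lemma free_color (c : T -> nat) (A : {set T}) :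
  #|A| < k -> exists2 i, i < k & {in A, forall y, c y != i}.
Proof.
move=> ltAk; pose used := [seq c y | y <- enum A].
have [/allP sub|] := boolP (all (mem used) (iota 0 k)).
  have := uniq_leq_size (iota_uniq 0 k) sub.
  by rewrite size_iota size_map -cardE leqNgt ltAk.
case/allPn=> i; rewrite mem_iota add0n => /andP[_ ltik] i_free.
exists i => // y yA; apply: contraNneq i_free => <-.
by apply: map_f; rewrite mem_enum.
Qed.

Lemma extend_coloring1 (D : {set T}) (x : T) :
    #|[set y in D | (y != x) && R x y]| < k ->
  partially_colorable D -> partially_colorable (x |: D).
Proof.
move=> few [c [c_lt c_ok]]; have [i ltik i_free] := free_color c few.
exists (fun y => if y == x then i else c y); split=> [y|y z].
  by rewrite !inE; case: eqP => //= _ /c_lt.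
rewrite !inE; case: eqP => [->|/eqP yx] /=; case: eqP => [->|/eqP zx] //=.
- by rewrite eqxx.
- move=> _ zD _ xz; rewrite eq_sym; apply: i_free.
  by rewrite inE zD zx xz.
- move=> yD _ _ yx'; apply: i_free.
  by rewrite inE yD yx R_sym yx'.
- exact: c_ok.
Qed.

(** The elements of [D :\: D'] are colored one at a time. Conflicts are counted in all of [D], which
    bounds those with the already colored elements whatever the order. *)
Lemma extend_coloring (D D' : {set T}) :
    D' \subset D ->
    {in D :\: D', forall x, #|[set y in D | (y != x) && R x y]| < k} ->
  partially_colorable D' -> partially_colorable D.
Proof.
move=> sD'D few colD'.
have ->: D = [set x in enum (D :\: D')] :|: D'.
  apply/setP=> x; rewrite !inE mem_enum !inE; case: (boolP (x \in D')) => /=.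
    by move/(subsetP sD'D)->.
  by rewrite orbF.
have: {subset enum (D :\: D') <= D :\: D'} by move=> x; rewrite mem_enum.
elim: (enum _) => [|x t IHt] sub; first by rewrite set_nil set0U.
rewrite set_cons -setUA; apply: extend_coloring1; last first.
  by apply: IHt => // y yt; apply: sub; rewrite inE yt orbT.
apply: leq_ltn_trans (few x (sub x (mem_head _ _))).
apply: subset_leq_card; apply/subsetP=> y; rewrite !inE => /andP[yD ->].
rewrite andbT; case/orP: yD => [yt|/(subsetP sD'D)//].
by have := sub y; rewrite !inE yt orbT => /(_ isT)/andP[].
Qed.

End Greedy.

(** * Conflicts between edges and how many there are *)

Section Conflicts.
Variable G : sgraph.
Implicit Types (W : {set G}) (X Y : {set G}) (x y z w u v : G).

(** Consecutive edges of a 4-cycle already meet, so only opposite pairs need the second clause. *)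
Definition conflict X Y : bool :=
  (X :&: Y != set0) || [exists x, exists y, exists z, exists w,
    [&& is_C4 x y z w, X == [set x; y] & Y == [set z; w]]].

Lemma conflictP X Y :
  reflect (X :&: Y != set0 \/ exists x y z w,
             [/\ is_C4 x y z w, X = [set x; y] & Y = [set z; w]])
          (conflict X Y).
Proof.
apply: (iffP orP) => -[XY|XY]; [by left| | by left|]; right.
  case/existsP: XY => x /existsP[y /existsP[z /existsP[w]]].
  by case/and3P=> C /eqP-> /eqP->; exists x, y, z, w.
case: XY => x [y [z [w [C -> ->]]]].
apply/existsP; exists x; apply/existsP; exists y; apply/existsP; exists z.
by apply/existsP; exists w; rewrite C !eqxx.
Qed.

Lemma is_C4_rot x y z w : is_C4 x y z w -> is_C4 y z w x.
Proof.
rewrite /is_C4 -[[:: y; z; w; x]]/(rot 1 [:: x; y; z; w]).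
by rewrite rot_uniq rot_cycle.
Qed.

Lemma conflict_sym : symmetric conflict.
Proof.
suff conflictW X Y : conflict X Y -> conflict Y X.
  by move=> X Y; apply/idP/idP; apply: conflictW.
case/conflictP=> [XY|[x [y [z [w [C -> ->]]]]]]; apply/conflictP.
  by left; rewrite setIC.
by right; exists z, w, x, y; split=> //; do 2 apply: is_C4_rot.
Qed.

Definition edges_in W : {set {set G}} := [set X in edges G | X \subset W].

Definition conflicts W X : {set {set G}} :=
  [set Y in edges_in W | (Y != X) && conflict X Y].

Lemma edgesP X :
  reflect (exists x y, adj x y /\ X = [set x; y]) (X \in edges G).
Proof.
apply: (iffP imsetP) => [[[x y] /= xy ->]|[x [y [xy ->]]]].
  by exists x, y; rewrite inE in xy.
by exists (x, y); rewrite ?inE.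
Qed.

Lemma C4_edges_conflict x y z w X Y :
    is_C4 x y z w -> X \in C4_edges x y z w -> Y \in C4_edges x y z w ->
  conflict X Y.
Proof.
move=> C; have C1 := is_C4_rot C; have C2 := is_C4_rot C1.
have C3 := is_C4_rot C2; rewrite /C4_edges !inE -!orbA => XC YC.
apply/conflictP.
have meet a : a \in X -> a \in Y -> X :&: Y != set0.
  by move=> aX aY; apply/set0Pn; exists a; rewrite inE aX.
case/or4P: XC => /eqP EX; case/or4P: YC => /eqP EY;
 solve [ left; apply: (meet x); by rewrite ?EX ?EY !inE eqxx ?orbT
       | left; apply: (meet y); by rewrite ?EX ?EY !inE eqxx ?orbT
       | left; apply: (meet z); by rewrite ?EX ?EY !inE eqxx ?orbT
       | left; apply: (meet w); by rewrite ?EX ?EY !inE eqxx ?orbT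
       | right; by exists x, y, z, w | right; by exists y, z, w, x
       | right; by exists z, w, x, y | right; by exists w, x, y, z].
Qed.

Lemma partially_colorable_B_colorable k :
  partially_colorable conflict k (edges_in setT) -> B_colorable G k.
Proof.
case=> c [c_lt c_ok].
have in_edges (X : edge G) : val X \in edges_in setT.
  by rewrite inE subsetT andbT (valP X).
pose col : {ffun edge G -> 'I_k} := [ffun X => Ordinal (c_lt _ (in_edges X))].
have col_ok (X Y : edge G) : X != Y -> conflict (val X) (val Y) ->
    col X != col Y.
  by move=> XY R; rewrite !ffunE -val_eqE; apply: c_ok.
apply/existsP; exists col; apply/andP; split.
  apply/forallP=> X; apply/forallP=> Y; apply/implyP=> /andP[XY meet].
  by apply: col_ok => //; apply/conflictP; left.
apply/forallP => x; apply/forallP => y; apply/forallP => z; apply/forallP => w.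
apply/implyP => C; apply/forallP => X; apply/forallP => Y.
apply/implyP => /and3P[XC YC XY].
by apply: col_ok => //; apply: C4_edges_conflict C XC YC.
Qed.

(** Only the edges meeting [[set v; u]] at [u] need the first alternative. An edge at [v] fits the
    second with [x = v], which is a common neighbor of [u] and [w]; an edge opposite to [[set v; u]]
    in a 4-cycle fits it directly. *)
Lemma conflict_edge W v u Y : adj v u -> v \in W -> u \in W ->
    Y \in edges_in W -> Y != [set v; u] -> conflict [set v; u] Y ->
  (exists2 x, x \in nbh u :&: W :\ v & Y = [set u; x]) \/
  (exists w x, [/\ w \in nbh v :&: W :\ u,
     x \in (nbh u :&: W) :&: (nbh w :&: W) & Y = [set w; x]]).
Proof.
move=> vu vW uW; rewrite inE => /andP[/edgesP[a [b [ab ->]]]] sub ne.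
have aW : a \in W by apply: (subsetP sub); rewrite !inE eqxx.
have bW : b \in W by apply: (subsetP sub); rewrite !inE eqxx orbT.
have uv : adj u v by rewrite adj_sym.
have vNu : v != u by apply: contraTneq vu => ->; rewrite adj_irr.
have incident a' b' : adj a' b' -> b' \in W -> [set a'; b'] != [set v; u] ->
    (a' == v) || (a' == u) ->
    (exists2 x, x \in nbh u :&: W :\ v & [set a'; b'] = [set u; x]) \/
    (exists w x, [/\ w \in nbh v :&: W :\ u,
      x \in (nbh u :&: W) :&: (nbh w :&: W) & [set a'; b'] = [set w; x]]).
  move=> ab' b'W ne' /orP[] /eqP Ea; rewrite {}Ea in ab' ne' *.
    right; exists b', v; rewrite setUC !inE b'W vW ab' uv adj_sym ab'.
    by split=> //; rewrite ?andbT; apply: (contraNneq _ ne') => ->.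
  left; exists b' => //; rewrite !inE b'W ab' !andbT.
  by apply: (contraNneq _ ne') => ->; rewrite setUC.
case/conflictP=> [/set0Pn[t]|[x [y [z [w [C Exy Ezw]]]]]].
  rewrite !inE => /andP[tvu /orP[] /eqP Et]; rewrite {}Et in tvu.
    exact: incident.
  rewrite [[set a; b]]setUC; apply: incident => //; first by rewrite adj_sym.
  by rewrite setUC.
have zW : z \in W by apply: (subsetP sub); rewrite Ezw !inE eqxx.
have wW : w \in W by apply: (subsetP sub); rewrite Ezw !inE eqxx orbT.
move: C; rewrite /is_C4 /= !inE !negb_or andbT.
case/andP=> /and3P[/and3P[xy xz xw] /andP[yz yw] zw].
case/and5P=> xy' yz' zw' wx' _; right; rewrite Ezw.
have := set21 x y; have := set22 x y; rewrite -Exy !inE.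
(* The cycle may run through the edge from [u] to [v] or from [v] to [u]; in each case the end of
   [Y] that follows or precedes [v] on the cycle is taken as the neighbor of [v]. *)
case/orP=> /eqP Ey; case/orP=> /eqP Ex; subst x y; rewrite ?eqxx // in xy.
  exists z, w; rewrite !inE zW wW yz' zw' adj_sym wx'.
  by rewrite eq_sym xz.
exists w, z; rewrite !inE zW wW yz' [adj v w]adj_sym wx' [adj w z]adj_sym zw'.
by rewrite eq_sym yw setUC.
Qed.

Lemma card_conflicts W v u : adj v u -> v \in W -> u \in W ->
  #|conflicts W [set v; u]|.+1
  <= #|nbh u :&: W| + \sum_(w in nbh v :&: W :\ u)
       #|(nbh u :&: W) :&: (nbh w :&: W)|.
Proof.
move=> vu vW uW.
have vN : v \in nbh u :&: W by rewrite !inE vW adj_sym vu.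
(* The successor is paid for by [v]: it lies in [nbh u :&: W], but [[set u; v]] is the edge itself
   and not one of its conflicts. *)
rewrite (cardsD1 v (nbh u :&: W)) vN add1n addSn ltnS.
set A := nbh u :&: W :\ v.
set C := fun w => (nbh u :&: W) :&: (nbh w :&: W).
apply: (@leq_trans #|[set [set u; x] | x in A] :|:
  \bigcup_(w in nbh v :&: W :\ u) [set [set w; x] | x in C w]|).
  apply: subset_leq_card; apply/subsetP=> Y; rewrite inE => /and3P[YW ne R].
  rewrite inE; have [[x xA ->]|[w [x [wB xC ->]]]] :=
    conflict_edge vu vW uW YW ne R.
    by apply/orP; left; apply/imsetP; exists x.
  by apply/orP; right; apply/bigcupP; exists w => //; apply/imsetP; exists x.
apply: leq_trans (leq_card_setU _ _) _; apply: leq_add.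
  exact: leq_imset_card.
apply: leq_trans (card_bigcup_le _ _) _.
by apply: leq_sum => w _; apply: leq_imset_card.
Qed.

(** * Degeneracy and the edge at which greedy coloring fails *)

Definition induced_adj W : rel G := fun x y => [&& x \in W, y \in W & adj x y].

Lemma induced_adj_sym W : symmetric (induced_adj W).
Proof. by move=> x y; rewrite /induced_adj adj_sym andbCA. Qed.

Lemma induced_adj_incl W x y :
  induced_adj W x y -> [/\ x \in W, y \in W & adj x y].
Proof. by case/and3P. Qed.

Definition induced W : subgraph G :=
  Subgraph (@induced_adj_sym W) (@induced_adj_incl W).

Lemma degenerate_vertex d W : degenerate d G -> W != set0 ->
  exists2 v, v \in W & #|nbh v :&: W| <= d.
Proof.
move=> degG /(degG (induced W))[v /= vW le_d]; exists v => //.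
apply: leq_trans le_d; apply: subset_leq_card; apply/subsetP=> y.
by rewrite !inE /= /induced_adj vW => /andP[-> ->].
Qed.

Lemma saturated_edge d k : degenerate d G -> ~~ B_colorable G k ->
  exists W v u, [/\ adj v u, v \in W, u \in W, #|nbh v :&: W| <= d &
    k <= #|conflicts W [set v; u]|].
Proof.
move=> degG notB.
(* Generalized to all vertex sets [W], for induction on a bound for [#|W|]; the case [W = setT] then
   contradicts [notB] unless a bad edge exists. *)
suff colorable_or n W : #|W| <= n ->
    partially_colorable conflict k (edges_in W) \/
    exists W v u, [/\ adj v u, v \in W, u \in W, #|nbh v :&: W| <= d &
                    k <= #|conflicts W [set v; u]|].
  have [/partially_colorable_B_colorable|//] := colorable_or _ setT (leqnn _).
  by rewrite (negPf notB).
elim: n W => [|n IHn] W leWn.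
  left; exists (fun=> 0); suff W0: edges_in W = set0.
    by rewrite W0; split=> [x|x y]; rewrite inE.
  move: leWn; rewrite leqn0 cards_eq0 => /eqP->.
  apply/setP=> X; rewrite !inE subset0; apply/andP=> -[/edgesP[x [y [_ ->]]]].
  by move/eqP/setP/(_ x); rewrite !inE eqxx.
have [W0|W0] := eqVneq W set0; first by apply: IHn; rewrite W0 cards0.
have [v vW le_d] := degenerate_vertex degG W0.
have [|colW'|] := IHn (W :\ v); last by right.
  by move: leWn; rewrite (cardsD1 v) vW.
have [|noBad] :=
  boolP [exists u, [&& adj v u, u \in W & k <= #|conflicts W [set v; u]|]].
  by case/existsP=> u /and3P[vu uW ge_k]; right; exists W, v, u.
(* The edges still to be colored lie in [W] but not in [W :\ v], so each of them contains [v], and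
   [noBad] bounds its conflicts. *)
left; apply: (extend_coloring conflict_sym) colW'.
  apply/subsetP=> X; rewrite !inE => /andP[->] /subset_trans-> //.
  exact: subsetDl.
move=> X; rewrite !inE => /andP[+ /andP[XE sXW]]; rewrite XE /= => nsX.
have [a [b [ab EX]]] := edgesP _ XE.
have vX : v \in X.
  apply: contraNT nsX => vNX; apply/subsetP=> t tX.
  by rewrite !inE (subsetP sXW) // andbT; apply: contraNneq vNX => <-.
have [u vu EX']: exists2 u, adj v u & X = [set v; u].
  move: vX; rewrite {1}EX !inE => /orP[] /eqP ->; first by exists b.
  by exists a; rewrite 1?adj_sym // EX setUC.
have uW : u \in W by apply: (subsetP sXW); rewrite EX' !inE eqxx orbT.
rewrite EX' ltnNge; apply: contraNN noBad => ge_k.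
by apply/existsP; exists u; rewrite vu uW.
Qed.

(** * Copies of complete bipartite graphs *)

Lemma contains_Kab a b (A B : {set G}) : a <= #|A| -> b <= #|B| ->
  {in A & B, forall x y, adj x y} -> contains_copy G (Kab a b).
Proof.
move=> leA leB AB.
pose fA (i : 'I_a) := enum_val (widen_ord leA i).
pose fB (i : 'I_b) := enum_val (widen_ord leB i).
have fAB i j : adj (fA i) (fB j) by apply: AB; apply: enum_valP.
have fA_inj : injective fA by move=> i j /enum_val_inj[/val_inj].
have fB_inj : injective fB by move=> i j /enum_val_inj[/val_inj].
have fANB i j : fA i != fB j.
  by apply: contraTneq (fAB i j) => ->; rewrite adj_irr.
pose f (x : Kab a b) : G := match x with inl i => fA i | inr j => fB j end.
have f_inj : injective f.
  case=> i [] j /= E; try by rewrite ?(fA_inj _ _ E) ?(fB_inj _ _ E).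
    by have := fANB i j; rewrite E eqxx.
  by have := fANB j i; rewrite E eqxx.
(* [G] may have edges inside [A] or inside [B]; the subgraph keeps only the images of the edges of
   [Kab a b]. *)
pose e : rel G := fun x y => [exists p, exists q,
  [&& f p == x, f q == y & adj p q]].
have eP x y : reflect (exists p q, [/\ f p = x, f q = y & adj p q]) (e x y).
  apply: (iffP existsP) => [[p /existsP[q /and3P[/eqP ? /eqP ? ?]]]|].
    by exists p, q.
  case=> p [q [Ep Eq pq]]; exists p; apply/existsP; exists q.
  by rewrite Ep Eq !eqxx.
have e_sym : symmetric e.
  by move=> x y; apply/eP/eP=> -[p [q [? ? ?]]]; exists q, p; rewrite adj_sym.
have e_incl x y : e x y ->
    [/\ x \in f @: [set: Kab a b], y \in f @: [set: Kab a b] & adj x y].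
  case/eP=> p [q [<- <- pq]]; rewrite !imset_f ?inE //; split=> //.
  have {pq}: Kab_adj p q := pq; case: p q => [i|i] [j|j] // _; first exact: fAB.
  by rewrite adj_sym; apply: fAB.
exists (Subgraph e_sym e_incl), f; split=> // x y /=.
apply/eP/idP => [[p [q [/f_inj-> /f_inj->]]]//|xy].
by exists x, y.
Qed.

End Conflicts.

(** * From a saturated edge to a star with small total defect *)

Lemma degree_le_max (G : sgraph) (x : G) : degree x <= max_degree G.
Proof. exact: (@leq_bigmax _ (@degree G)). Qed.

Lemma not_B_colorable (G : sgraph) (k : nat) : k < qB G -> ~~ B_colorable G k.
Proof.
rewrite /qB; case: ex_minnP => m _ min_m ltkm.
by apply: contraTN ltkm => /min_m; rewrite leqNgt.
Qed.

(** Here [n] counts the neighbors [w != u] of [v] in [W], [D] those of [u] in [W], and [S], [T] are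
    the sums of common and of missing neighbors. The hypotheses give
    [d * Delta <= n.+1 * D + s - T]. If [n.+1 < d], the right side loses at least [Delta > s]; if
    then [D < Delta], it loses at least [d > s]. With both equalities, [T <= s] is what remains. *)
Lemma saturated_star_counts (d Delta s n D S T : nat) :
    s < d -> d <= Delta -> n < d -> D <= Delta -> S + T = n * D ->
    d * Delta - s <= D + S ->
  [/\ n.+1 = d, D = Delta & T <= s].
Proof.
move=> lt_sd le_d lt_nd le_D ST ge_k.
have total : d * Delta <= n.+1 * D + s - T by rewrite mulSn; lia.
have En : n.+1 = d.
  apply/eqP; rewrite eqn_leq lt_nd leqNgt; apply/negP=> lt_n.
  have : n.+2 * Delta <= d * Delta by rewrite leq_mul2r lt_n orbT.
  have : n.+1 * D <= n.+1 * Delta by rewrite leq_mul2l le_D orbT.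
  by rewrite [n.+2 * _]mulSn; lia.
have ED : D = Delta.
  apply/eqP; rewrite eqn_leq le_D leqNgt; apply/negP=> lt_D.
  have : n.+1 * D.+1 <= n.+1 * Delta by rewrite leq_mul2l lt_D orbT.
  by rewrite mulnS -En in total *; lia.
by split=> //; rewrite En ED in total; lia.
Qed.

Lemma saturated_star (d Delta s : nat) (G : sgraph) :
    s < d -> d <= Delta -> degenerate d G -> max_degree G <= Delta ->
    d * Delta - s <= qB G ->
  exists (v u : G) (B : {set G}),
    [/\ B \subset nbh v, u \in B, #|B| = d, degree u = Delta
      & \sum_(w in B :\ u) #|nbh u :\: nbh w| <= s].
Proof.
move=> lt_sd le_d degG maxG qG.
have le_sdD : s < d * Delta by nia.
(* By [le_sdD] the predecessor is genuine: one color fewer than the lower bound on [qB G]. *)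
have notB : ~~ B_colorable G (d * Delta - s).-1.
  by apply: not_B_colorable; lia.
have [W [v [u [vu vW uW cardB ge_k]]]] := saturated_edge degG notB.
have {}ge_k := leq_ltn_trans ge_k (card_conflicts vu vW uW).
set B := nbh v :&: W in cardB ge_k; set Nu := nbh u :&: W in ge_k.
have uB : u \in B by rewrite !inE vu uW.
have deg_le : #|nbh u| <= Delta.
  by apply: leq_trans maxG; apply: degree_le_max.
have Nu_sub : Nu \subset nbh u := subsetIl _ _.
have sumE : \sum_(w in B :\ u) #|Nu :&: (nbh w :&: W)| +
    \sum_(w in B :\ u) #|Nu :\: (nbh w :&: W)| = #|B :\ u| * #|Nu|.
  rewrite -big_split /= -sum_nat_const; apply: eq_bigr => w _.
  exact: cardsID.
rewrite (cardsD1 u) uB add1n in cardB.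
have [||En ED le_s] := saturated_star_counts lt_sd le_d cardB _ sumE.
- exact: leq_trans (subset_leq_card Nu_sub) deg_le.
- by lia.
(* As [Nu] already has [Delta] elements, no neighbor of [u] lies outside [W]. *)
have ENu : Nu = nbh u by apply/eqP; rewrite eqEcard Nu_sub ED.
exists v, u, B; split=> //; first exact: subsetIl.
- by rewrite (cardsD1 u) uB add1n.
- by rewrite /degree -ENu.
(* Neighbors of [w] outside [W] can only lower the defect. *)
apply: leq_trans le_s; apply: leq_sum => w _; apply: subset_leq_card.
by rewrite ENu; apply: setDS; apply: subsetIl.
Qed.

(** Converts sums over a set of neighbors into sums over indices, with the distinguished vertex at
    index 0. *)
Lemma enumerate_set_from (T : finType) (n : nat) (B : {set T}) (u : T) :
    u \in B -> #|B| = n.+1 ->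
  exists f : 'I_n.+1 -> T,
    [/\ injective f, f @: setT = B, f ord0 = u
      & forall F : T -> nat,
          \sum_(j < n.+1 | 0 < j) F (f j) = \sum_(w in B :\ u) F w].
Proof.
move=> uB cardB; pose t := u :: enum (B :\ u).
have size_t : size t = n.+1.
  by rewrite /= -cardE; move: cardB; rewrite (cardsD1 u) uB.
have t_uniq : uniq t by rewrite /= mem_enum !inE eqxx enum_uniq.
have mem_t w : (w \in t) = (w \in B).
  by rewrite inE mem_enum !inE; case: eqP => [->|].
pose f (j : 'I_n.+1) := nth u t j.
have f_inj : injective f.
  move=> i j /eqP; rewrite nth_uniq ?size_t // => /eqP; exact: val_inj.
exists f; split=> //.
  apply/eqP; rewrite eqEcard card_imset // cardsT card_ord cardB leqnn andbT.
  by apply/subsetP=> _ /imsetP[j _ ->]; rewrite -mem_t mem_nth ?size_t.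
move=> F; rewrite big_mkcond big_ord_recl /= add0n.
rewrite -[RHS]big_enum (big_nth u) big_mkord -cardE.
have -> : #|B :\ u| = n by move: size_t => /= [<-]; rewrite -cardE.
by apply: eq_bigr.
Qed.

Theorem corollary2p4 (d Delta s : nat) (d_gt0 : 0 < d) (d_le : d <= Delta)
    (s_lt : s < d) (G : sgraph) (degG : degenerate d G)
    (maxG : max_degree G <= Delta) (qG : qB G >= d * Delta - s) :
  (exists (v : G) (u : 'I_d -> G),
     let u1 := u (Ordinal d_gt0) in
     [/\ injective u /\ (forall j, u j \in nbh v),
         degree u1 = Delta,
         \sum_(j < d | 0 < j) #|nbh u1 :\: nbh (u j)| <= s,
         \sum_(j < d | 0 < j) #|symdiff (nbh u1) (nbh (u j))| <= 2 * s
       & exists J : {set 'I_d},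
           [/\ d - s <= #|J|,
               forall j, j \in J -> degree (u j) = Delta
             & forall i j, i \in J -> j \in J -> nbh (u i) = nbh (u j)]])
  /\ contains_copy G (Kab (d - s) Delta)
  /\ contains_copy G (Kab d (Delta - s)).
Proof.
have [v [u1 [B [sBN u1B cardB deg_u1 defect]]]] :=
  saturated_star s_lt d_le degG maxG qG.
have deg_le (w : G) : #|nbh w| <= Delta.
  by apply: leq_trans maxG; apply: degree_le_max.
(* Both differences complete the same intersection, and [u1] has the largest possible degree
   [Delta]. *)
have defectC (w : G) : #|nbh w :\: nbh u1| <= #|nbh u1 :\: nbh w|.
  have := cardsID (nbh w) (nbh u1); have := cardsID (nbh u1) (nbh w).
  rewrite setIC; have := deg_le w; rewrite -deg_u1 /degree; lia.
pose E := [set w in B | nbh w == nbh u1].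
have cardE : d - s <= #|E|.
  (* Each [w] in [B :\: E] adds at least 1 to the defect: if [nbh u1] were contained in [nbh w], the
     bound [Delta] on [#|nbh w|] would force equality. *)
  have : #|B :\: E| <= s.
    apply: leq_trans defect; rewrite -sum1_card.
    rewrite [leqRHS](big_setID (B :\: E)) /=.
    apply: leq_trans (leq_addr _ _).
    rewrite (_ : (B :\ u1) :&: (B :\: E) = B :\: E); last first.
      apply/setIidPr/subsetP=> w /setDP[wB wE]; rewrite !inE wB andbT.
      by apply: contraNneq wE => ->; rewrite inE u1B eqxx.
    apply: leq_sum => w /setDP[wB]; rewrite inE wB /= => ne.
    rewrite lt0n cards_eq0 setD_eq0; apply: contraNN ne => sub.
    by rewrite eq_sym eqEcard sub (leq_trans (deg_le w)) // -deg_u1.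
  have := cardsID E B; rewrite cardB (setIidPr _) ?subsetIl //; last first.
    by apply/subsetP=> w; rewrite inE => /andP[].
  by lia.
split; last split.
- case: d d_gt0 {d_le s_lt degG qG} cardB cardE => // n n_gt0 cardB cardE.
  have [f [f_inj imf f0 sumf]] := enumerate_set_from u1B cardB.
  have -> : Ordinal n_gt0 = ord0 by apply: val_inj.
  exists v, f; rewrite f0 /=; split=> //.
  + split=> // j; apply: (subsetP sBN); rewrite -imf; exact: imset_f.
  + by rewrite (sumf (fun w => #|nbh u1 :\: nbh w|)).
  (* By [defectC] each symmetric difference is at most twice the one-sided defect. *)
  + rewrite (sumf (fun w => #|symdiff (nbh u1) (nbh w)|)).
    apply: leq_trans (leq_mul (leqnn 2) defect); rewrite big_distrr /=.
    apply: leq_sum => w _; apply: leq_trans (leq_card_setU _ _) _.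
    by rewrite mul2n -addnn leq_add2l.
  exists (f @^-1: E); split.
  + rewrite -(card_imset _ f_inj); apply: leq_trans cardE _.
    apply: subset_leq_card; apply/subsetP=> w wE.
    have : w \in f @: setT by rewrite imf; case/setIdP: wE.
    by case/imsetP=> j _ Ew; rewrite Ew imset_f // inE -Ew.
  + by move=> j; rewrite !inE -deg_u1 /degree => /andP[_ /eqP->].
  + by move=> i j; rewrite !inE => /andP[_ /eqP->] /andP[_ /eqP->].
- apply: (contains_Kab (A := E) (B := nbh u1)) => //; first by rewrite -deg_u1.
  by move=> x y; rewrite inE => /andP[_ /eqP<-]; rewrite inE.
(* A vertex of [nbh u1] outside the common neighborhood of [B] is missed by some [w] in [B :\ u1];
   the total defect allows at most [s] such vertices, leaving [Delta - s]. *)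
apply: (contains_Kab (A := B) (B := \bigcap_(w in B) nbh w)).
- by rewrite cardB.
- have sub : nbh u1 \subset (\bigcap_(w in B) nbh w) :|:
      \bigcup_(w in B :\ u1) (nbh u1 :\: nbh w).
    apply/subsetP=> x xu1; rewrite inE orbC; have [//|nbad] := boolP (x \in _).
    apply/bigcapP=> w wB; apply: contraNT nbad => xw; apply/bigcupP; exists w.
      by rewrite !inE wB andbT; apply: contraNneq xw => ->.
    by rewrite inE xw.
  rewrite leq_subLR -deg_u1 addnC.
  apply: leq_trans (subset_leq_card sub) _.
  apply: leq_trans (leq_card_setU _ _) _; rewrite leq_add2l.
  exact: leq_trans (card_bigcup_le _ _) defect.
by move=> x y xB /bigcapP/(_ x xB); rewrite inE.
Qed.
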